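(* One has $153\le f(3,6)\le255$.
   Context: $f(w,k)$ denotes the maximum size of a finite family of distinct $w$-element sets (on an arbitrary finite ground set) containing no $k$-sunflower. A $k$-sunflower is a collection of $k$ distinct sets $A_1,\dots,A_k$ for which there is a set $C$ (the core, possibly empty) with $A_i\cap A_j=C$ for all $i\ne j$. *)

(* Defs.v *)
From mathcomp Require Import all_boot.
(* Not imported, since its set lemmas would shadow those of finset. *)
From mathcomp Require classical_sets.

Set Implicit Arguments.
Unset Strict Implicit.
Unset Printing Implicit Defensive.

Definition sunflower (T : finType) (k : nat) (S : {set {set T}}) : Prop :=
  #|S| = k /\
  exists C : {set T}, {in S &, forall A B, A != B -> A :&: B = C}.

Definition sunflower_free (T : finType) (k : nat) (F : {set {set T}}) : Prop :=
  forall S : {set {set T}}, S \subset F -> ~ sunflower k S.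

Definition uniform (T : finType) (w : nat) (F : {set {set T}}) : Prop :=
  {in F, forall A : {set T}, #|A| = w}.

(* The ground set T is quantified here, so it is not fixed in advance. *)
Definition sunflower_free_size (w k m : nat) : Prop :=
  exists (T : finType) (F : {set {set T}}),
    [/\ uniform w F, sunflower_free k F & #|F| = m].

Definition is_max_sunflower_free_size (w k m : nat) : Prop :=
  sunflower_free_size w k m /\
  forall n, sunflower_free_size w k n -> n <= m.

(* f(w, k); the value is 0 by convention when there is no maximum, so a
   positive value is always an attained maximum (see
   sunflower_numberP). *)
Definition sunflower_number (w k : nat) : nat :=
  classical_sets.xget 0 (is_max_sunflower_free_size w k).

Lemma is_max_sunflower_free_size_uniq w k m n :
  is_max_sunflower_free_size w k m -> is_max_sunflower_free_size w k n -> m = n.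
Proof.
move=> [szm maxm] [szn maxn]; apply/eqP.
by rewrite eqn_leq maxn // maxm.
Qed.

Lemma sunflower_numberE w k m : is_max_sunflower_free_size w k m -> sunflower_number w k = m.
Proof.
move=> maxm; rewrite /sunflower_number; case: classical_sets.xgetP => [n _ maxn | nomax].
  exact: is_max_sunflower_free_size_uniq maxn maxm.
by case: (nomax m).
Qed.

Lemma sunflower_numberP w k : 0 < sunflower_number w k -> is_max_sunflower_free_size w k (sunflower_number w k).
Proof. by rewrite /sunflower_number; case: classical_sets.xgetP => [n _|]. Qed.

(* Main.v *)
(** Upper bound. Let M be a largest set of pairwise disjoint members of F and V its
    union, so that #|M| <= 5 and #|V| = 3 #|M|. In the link of a point degrees and
    matchings are at most 5, hence by the Chvatal-Hanson bound it has at most 27 edges.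
    Each A in F satisfies 2 + [A in M] <= #|A :&: V| + [#|A :&: V| = 1]. The first term on the
    right sums to at most 27 #|V|. For the second, fix B in M: the sets meeting V in a single
    point a of B form a graph outside V with no five disjoint edges (they could be
    extended by B :\ a), and the graphs at distinct points of B are cross-intersecting by
    maximality of M, which leaves at most 22 sets. So 2 #|F| <= (81 + 22 - 1) #|M| <= 510.

    Lower bound. On 14 points take 126 triples such that every point has 11 neighbours and
    every pair lies in at most 5 triples; add a disjoint star whose link is a graph with 27
    edges and maximum degree 5 on 11 points. Six petals of size 2 need 12 neighbours of
    the core, and six disjoint triples, at most one of which lies in the star, need
    15 of the 14 points. *)

Require Import Defs.
From mathcomp Require Import all_boot zify.
From mathcomp Require boolp.

Set Implicit Arguments.
Unset Strict Implicit.
Unset Printing Implicit Defensive.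

(** * Graphs of maximum degree five *)

Lemma sum_cardI_degree (T : finType) (X : {set {set T}}) (V : {set T}) :
  \sum_(A in X) #|A :&: V| = \sum_(v in V) #|[set A in X | v \in A]|.
Proof.
transitivity (\sum_(A in X) \sum_(v in V) (v \in A : nat)).
  apply: eq_bigr => A _; rewrite -sum1_card big_mkcond /= [RHS]big_mkcond /=.
  by apply: eq_bigr => v _; rewrite inE; case: (v \in A); case: (v \in V).
rewrite exchange_big; apply: eq_bigr => v _.
rewrite -sum1_card big_mkcond /= [RHS]big_mkcond /=.
by apply: eq_bigr => A _; rewrite inE; case: (A \in X); case: (v \in A).
Qed.

Lemma trivIset_insert (T : finType) (e : {set T}) (M : {set {set T}}) :
  [disjoint e & cover M] -> trivIset M -> trivIset (e |: M).
Proof.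
move=> dis /trivIsetP triv.
have disM f : f \in M -> [disjoint e & f].
  by move=> fM; apply: disjointWr dis; apply: bigcup_sup.
apply/trivIsetP => A B; rewrite !inE => /predU1P[->|AM] /predU1P[->|BM] //.
- by rewrite eqxx.
- by move=> _; apply: disM.
- by move=> _; rewrite disjoint_sym; apply: disM.
- exact: triv.
Qed.

Lemma trivIset_eq (T : finType) (M : {set {set T}}) (e f : {set T}) (x : T) :
  trivIset M -> e \in M -> f \in M -> x \in e -> x \in f -> e = f.
Proof.
move=> /trivIsetP triv eM fM xe xf; apply/eqP/negPn/negP => nef.
by have /pred0P/(_ x) := triv _ _ eM fM nef; rewrite /= xe xf.
Qed.

Lemma set_eq_pair (T : finType) (e : {set T}) (u v : T) :
  #|e| = 2 -> u \in e -> v \in e -> u != v -> e = [set u; v].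
Proof.
move=> e2 ue ve uv; apply/esym/eqP; rewrite eqEcard cards2 uv e2 leqnn andbT.
by apply/subsetP => x; rewrite !inE => /orP[] /eqP->.
Qed.

(** * Maximum matchings and Gallai's lemma *)

Section Matchings.
Variables (T : finType) (E : {set {set T}}).

Definition is_matching (M : {set {set T}}) := (M \subset E) && trivIset M.

Definition is_max_matching (M : {set {set T}}) :=
  is_matching M && [forall N, is_matching N ==> (#|N| <= #|M|)].

Lemma max_matching_exists : exists M, is_max_matching M.
Proof.
have m0 : is_matching set0.
  by rewrite /is_matching sub0set; apply/trivIsetP => A B; rewrite inE.
case: (arg_maxnP (fun M : {set {set T}} => #|M|) m0) => M mM maxM.
by exists M; rewrite /is_max_matching mM; apply/forall_inP.
Qed.

Lemma max_matchingP M : is_max_matching M ->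
  [/\ M \subset E, trivIset M & forall N, is_matching N -> #|N| <= #|M|].
Proof. by case/andP => /andP[? ?] /forall_inP. Qed.

(** Otherwise [e] could be added to [M]; being nonempty, it cannot already be a member. *)
Lemma max_matching_hits M e : set0 \notin E -> is_max_matching M -> e \in E ->
  ~~ [disjoint e & cover M].
Proof.
move=> E0 /max_matchingP[ME triv maxM] eE; apply/negP => dis.
have eM : e \notin M.
  apply/negP => eM; move: dis; rewrite disjoint_sym => dis.
  have: [disjoint e & e] by apply: disjointWl dis; apply: bigcup_sup.
  by rewrite -setI_eq0 setIid => /eqP e0; rewrite -e0 eE in E0.
have := maxM (e |: M); rewrite /is_matching subUset sub1set eE ME /=.
by rewrite trivIset_insert // cardsU1 eM /= add1n ltnn => /(_ isT).
Qed.

Hypothesis card_edge : {in E, forall e : {set T}, #|e| = 2}.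

Lemma set0_notin_graph : set0 \notin E.
Proof. by apply/negP => /card_edge; rewrite cards0. Qed.

Lemma card_cover_matching M : is_matching M -> #|cover M| = 2 * #|M|.
Proof.
case/andP => /subsetP ME /eqP <-.
under eq_bigr => A AM do rewrite card_edge ?ME //.
by rewrite sum_nat_const mulnC.
Qed.

Hypothesis missed : forall v, exists2 M, is_max_matching M & v \notin cover M.

(** Equality is put in by hand, since under [missed] every vertex is missed together with itself. *)
Definition never_both_missed u v :=
  (u == v) || ~~ [exists M, [&& is_max_matching M, u \notin cover M & v \notin cover M]].

Lemma never_both_missedP u v M : never_both_missed u v -> u != v ->
  is_max_matching M -> u \notin cover M -> v \in cover M.
Proof.
move=> /orP[->//|/existsPn/(_ M) Ruv] _ mM uM.
by rewrite mM uM negbK in Ruv.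
Qed.

Lemma never_both_missed_sym u v : never_both_missed u v = never_both_missed v u.
Proof.
rewrite /never_both_missed eq_sym; congr (_ || ~~ _).
by apply: eq_existsb => M; rewrite [X in _ && X]andbC.
Qed.

(* Gallai's exchange argument: among the maximum matchings missing [t], take one
   sharing as many edges as possible with a maximum matching missing [u] and [v]. *)
Lemma never_both_missed_trans t u v :
  never_both_missed u t -> never_both_missed t v -> never_both_missed u v.
Proof.
have [->//|ut] := eqVneq u t; have [->//|tv] := eqVneq t v.
move=> Rut Rtv; rewrite /never_both_missed; case: eqVneq => //= uv.
apply/existsPn => M; apply/negP => /and3P[mM uM vM].
have [N0 mN0 tN0] := missed t.
have P0 : is_max_matching N0 && (t \notin cover N0) by apply/andP.
case: (arg_maxnP (P := fun N => is_max_matching N && (t \notin cover N))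
  (fun N : {set {set T}} => #|M :&: N|) P0) => N /andP[mN tN] maxN {N0 mN0 tN0 P0}.
have tM : t \in cover M by apply: never_both_missedP Rut _ mM uM.
have uN : u \in cover N.
  by apply: (never_both_missedP (u := t)) mN tN; rewrite 1?never_both_missed_sym // eq_sym.
have vN : v \in cover N by apply: never_both_missedP Rtv tv mN tN.
have [ME trivM maxM] := max_matchingP mM.
have [NE trivN maxN'] := max_matchingP mN.
have matM : is_matching M by case/andP: mM.
have matN : is_matching N by case/andP: mN.
have sMN : #|M| = #|N| by apply/eqP; rewrite eqn_leq maxM // maxN'.
have scard : #|cover M :\: cover N| = #|cover N :\: cover M|.
  apply/eqP; rewrite -(eqn_add2l #|cover M :&: cover N|) cardsID setIC cardsID.
  by rewrite !card_cover_matching // sMN.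
(* [u] and [v] are covered by [N] only, so at least two vertices are covered by [M] only, and one of
   them is not [t]. *)
have [x xMN xt] : exists2 x, x \in cover M :\: cover N & x != t.
  have tMN : t \in cover M :\: cover N by rewrite inE tN.
  have : 0 < #|(cover M :\: cover N) :\ t|.
    have : #|[set u; v]| <= #|cover N :\: cover M|.
      by apply: subset_leq_card; apply/subsetP => z; rewrite !inE => /orP[]/eqP->; apply/andP.
    by rewrite cards2 uv -scard (cardsD1 t) tMN.
  by case/card_gt0P => x; rewrite in_setD1 => /andP[]; exists x.
move: xMN; rewrite inE => /andP[xN /bigcupP[e eM xe]].
have eE := subsetP ME _ eM.
have /pred0Pn[y /andP[/= ye yN]] := max_matching_hits set0_notin_graph mN eE.
have xy : x != y by apply: contraNneq xN => ->.
have e_def := set_eq_pair (card_edge eE) xe ye xy.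
have /bigcupP[f fN yf] := yN.
have eN : e \notin N by apply: contra xN => eN; apply/bigcupP; exists e.
have fM : f \notin M.
  apply: contra eN => fM.
  by rewrite (trivIset_eq trivM eM fM ye yf).
(* Trading [f] for [e] gives a maximum matching that still misses [t] but shares one more edge with
   [M], against the choice of [N]. *)
set N' := e |: (N :\ f).
have dis : [disjoint e & cover (N :\ f)].
  apply/pred0P => z /=; apply/negP => /andP[ze /bigcupP[g]].
  rewrite !inE => /andP[gf gN] zg.
  move: ze; rewrite e_def !inE => /orP[]/eqP ez; rewrite ez in zg.
    by move/negP: xN; apply; apply/bigcupP; exists g.
  by move/eqP: gf; apply; apply: trivIset_eq trivN gN fN zg yf.
have matN' : is_matching N'.
  rewrite /is_matching subUset sub1set eE (subset_trans (subsetDl _ _) NE) /=.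
  by apply: trivIset_insert dis (trivIsetS (subsetDl _ _) trivN).
have cN' : #|N'| = #|N|.
  by rewrite cardsU1 !inE (negbTE eN) andbF /= [RHS](cardsD1 f) fN.
have mN' : is_max_matching N'.
  by rewrite /is_max_matching matN' cN'; case/andP: mN.
have tN' : t \notin cover N'.
  rewrite /cover bigcup_setU big_set1 inE negb_or; apply/andP; split.
    rewrite e_def !inE negb_or eq_sym xt /=; apply: contraNneq tN => ->.
    exact: yN.
  apply: contra tN => /bigcupP[g]; rewrite !inE => /andP[_ gN] tg.
  by apply/bigcupP; exists g.
have := maxN N'; rewrite mN' tN' => /(_ isT); apply/negP; rewrite -ltnNge.
have -> : M :&: N' = e |: (M :&: N).
  apply/setP => g; rewrite !inE; case: eqVneq => [->|_] /=; first by rewrite eM.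
  by case: eqVneq => [->|_] //=; rewrite (negbTE fM).
by rewrite cardsU1 !inE (negbTE eN) andbF.
Qed.

Lemma never_both_missed_equiv :
  {in [set: T] & &, equivalence_rel never_both_missed}.
Proof.
move=> x y z _ _ _; split; first by rewrite /never_both_missed eqxx.
move=> Rxy; apply/idP/idP; last exact: never_both_missed_trans.
by apply: never_both_missed_trans; rewrite never_both_missed_sym.
Qed.

Definition gallai_class := equivalence_partition never_both_missed [set: T].

Lemma gallai_class_partition : partition gallai_class [set: T].
Proof. exact/equivalence_partitionP/never_both_missed_equiv. Qed.

(** Exactly one class contains [e]: its ends are equivalent, since a maximum matching missing both
    could be extended by [e]. *)
Lemma edge_in_gallai_class e : e \in E ->
  \sum_(D in gallai_class) (e \subset D : nat) = 1.
Proof.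
move=> eE; have /eqP/cards2P[u [v [uv e_def]]] := card_edge eE.
have uP : u \in cover gallai_class.
  by case/and3P: gallai_class_partition => /eqP-> _ _; rewrite inE.
have triv : trivIset gallai_class by case/and3P: gallai_class_partition.
have Ruv : v \in pblock gallai_class u.
  rewrite pblock_equivalence_partition ?inE //; last exact: never_both_missed_equiv.
  rewrite /never_both_missed (negbTE uv) /=; apply/existsPn => M.
  apply/negP => /and3P[mM uM vM].
  have /pred0Pn[y /andP[/= ye yM]] := max_matching_hits set0_notin_graph mM eE.
  by move: ye yM; rewrite e_def !inE => /orP[]/eqP->; apply/negP.
rewrite (bigD1 (pblock gallai_class u)) ?pblock_mem //=.
rewrite big1 => [|D /andP[DP Du]].
  by rewrite e_def subUset !sub1set mem_pblock uP Ruv.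
apply/eqP; rewrite eqb0; apply: contra Du => eD.
by rewrite -(def_pblock triv DP (x := u)) // (subsetP eD) // e_def !inE eqxx.
Qed.

Lemma sum_gallai_class (X : {set {set T}}) : X \subset E ->
  \sum_(D in gallai_class) #|[set e in X | e \subset D]| = #|X|.
Proof.
move=> /subsetP XE.
transitivity (\sum_(D in gallai_class) \sum_(e in X) (e \subset D : nat)).
  apply: eq_bigr => D _; rewrite -sum1_card big_mkcond /= [RHS]big_mkcond /=.
  by apply: eq_bigr => A _; rewrite inE; case: (A \in X); case: (_ \subset _).
rewrite exchange_big -sum1_card /=; apply: eq_bigr => e eX.
by rewrite edge_in_gallai_class ?XE.
Qed.

(** [M] misses at most one vertex of a class, and the covered ones lie on edges of [M] inside [D],
    since no edge leaves its class. *)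
Lemma card_gallai_class M D : is_max_matching M -> D \in gallai_class ->
  #|D| <= (2 * #|[set e in M | e \subset D]|).+1.
Proof.
move=> mM DP; have [ME triv _] := max_matchingP mM.
have triv' : trivIset gallai_class by case/and3P: gallai_class_partition.
have Dcov : #|D :\: cover M| <= 1.
  apply/card_le1_eqP => u v; rewrite !inE => /andP[uM uD] /andP[vM vD].
  have : never_both_missed u v.
    rewrite -(pblock_equivalence_partition never_both_missed_equiv) ?inE //.
    by rewrite (def_pblock triv' DP uD).
  have [//|uv Ruv] := eqVneq u v.
  by rewrite (never_both_missedP Ruv uv mM uM) in vM.
have : #|D :&: cover M| <= 2 * #|[set e in M | e \subset D]|.
  rewrite -card_cover_matching; last first.
    rewrite /is_matching; apply/andP; split.
      by apply/subsetP => e; rewrite inE => /andP[/(subsetP ME)].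
    by apply: trivIsetS triv; apply/subsetP => e; rewrite inE => /andP[].
  apply: subset_leq_card; apply/subsetP => x; rewrite inE.
  move=> /andP[xD /bigcupP[e eM xe]]; apply/bigcupP; exists e => //.
  rewrite inE eM /=; have eE := subsetP ME _ eM.
  have : 0 < \sum_(D in gallai_class) (e \subset D : nat).
    by rewrite edge_in_gallai_class.
  rewrite lt0n sum_nat_eq0 => /forall_inPn[D' D'P]; rewrite eqb0 negbK => eD'.
  rewrite -(def_pblock triv' DP xD) (def_pblock triv' D'P) //.
  exact: (subsetP eD').
have := cardsID (cover M) D; lia.
Qed.

Hypothesis degree_le5 : forall v, #|[set e in E | v \in e]| <= 5.

(** The degree sum gives at most [5 * k + 2] edges, which suffices for [3 <= k]; for smaller [k] the
    number of pairs of vertices, at most 0, 3 or 10, is used. *)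
Lemma card_edges_within (D : {set T}) k : #|D| <= (2 * k).+1 ->
  #|[set e in E | e \subset D]| <= 5 * k + 2 * (k %/ 3).
Proof.
move=> Dk; set X := [set e in E | e \subset D].
have XE : X \subset E by apply/subsetP => e; rewrite inE => /andP[].
have deg : 2 * #|X| <= #|D| * 5.
  rewrite mulnC -sum_nat_const.
  have -> : \sum_(e in X) 2 = \sum_(e in X) #|e :&: D|.
    apply: eq_bigr => e; rewrite inE => /andP[eE /setIidPl->].
    by rewrite card_edge.
  rewrite sum_cardI_degree -sum_nat_const; apply: leq_sum => v _.
  apply: leq_trans (degree_le5 v); apply: subset_leq_card; apply/subsetP => e.
  by rewrite !inE => /andP[/andP[-> _] ->].
have bin : #|X| <= 'C(#|D|, 2).
  rewrite -cards_draws; apply: subset_leq_card; apply/subsetP => e.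
  by rewrite !inE => /andP[eE ->]; rewrite card_edge.
have [k3|k3] := leqP 3 k; first lia.
have := leq_trans bin (leq_bin2l 2 Dk).
by case: k k3 {Dk} => [|[|[|]]] // _ /leq_trans->.
Qed.

Lemma card_graph_all_missed M : is_max_matching M ->
  #|E| <= 5 * #|M| + 2 * (#|M| %/ 3).
Proof.
move=> mM; have [ME _ _] := max_matchingP mM.
(* Both counts are sums over the classes, and division by 3 rounded down is superadditive. *)
rewrite -(sum_gallai_class ME) -{1}(sum_gallai_class (subxx E)).
elim/big_ind2: _ => //.
  move=> x1 x2 y1 y2; lia.
by move=> D DP; apply: card_edges_within; apply: card_gallai_class.
Qed.

End Matchings.

(* The case of maximum degree five of the Chvatal-Hanson bound. A vertex covered by
   every maximum matching is deleted; if there is none, Gallai's lemma applies. *)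
Lemma card_graph_bound (T : finType) m (E : {set {set T}}) :
  {in E, forall e : {set T}, #|e| = 2} ->
  (forall v, #|[set e in E | v \in e]| <= 5) ->
  (forall M : {set {set T}}, M \subset E -> trivIset M -> #|M| <= m) ->
  #|E| <= 5 * m + 2 * (m %/ 3).
Proof.
elim: m E => [|m IHm] E E2 deg mat;
  have [M0 mM0] := max_matching_exists E;
  have [M0E triv0 max0] := max_matchingP mM0;
  have [/forallP allv|] := boolP [forall v, [exists M : {set {set T}}, is_max_matching E M && (v \notin cover M)]].
- have missed v : exists2 M, is_max_matching E M & v \notin cover M.
    by have /existsP[M /andP[]] := allv v; exists M.
  apply: leq_trans (card_graph_all_missed E2 missed deg mM0) _.
  by have := mat _ M0E triv0; lia.
- case/forallPn => v /existsPn/(_ M0); rewrite mM0 /= negbK => /bigcupP[e eM _].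
  have := mat _ M0E triv0; rewrite leqn0 cards_eq0 => /eqP M00.
  by rewrite M00 inE in eM.
- have missed v : exists2 M, is_max_matching E M & v \notin cover M.
    by have /existsP[M /andP[]] := allv v; exists M.
  apply: leq_trans (card_graph_all_missed E2 missed deg mM0) _.
  by have := mat _ M0E triv0; lia.
case/forallPn => v /existsPn Hv.
pose E' := [set e in E | v \notin e].
have E'E : E' \subset E by apply/subsetP => e; rewrite inE => /andP[].
have : #|E'| <= 5 * m + 2 * (m %/ 3).
  apply: IHm => [e /(subsetP E'E)/E2//|x|M ME' triv].
    apply: leq_trans (deg x); apply: subset_leq_card; apply/subsetP => e.
    by rewrite !inE => /andP[/andP[-> _] ->].
  have ME := subset_trans ME' E'E.
  (* A matching of [m.+1] edges avoiding [v] would be a maximum matching of [E] missing [v]. *)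
  have := mat _ ME triv; rewrite leq_eqVlt => /predU1P[cM|]; last lia.
  have /negP[] := Hv M; apply/andP; split.
    rewrite /is_max_matching /is_matching ME triv /=; apply/forall_inP => N /andP[NE tN].
    by rewrite cM; apply: mat.
  apply/negP => /bigcupP[e /(subsetP ME')]; rewrite inE => /andP[_ /negP ve].
  exact: ve.
have -> : #|E| = #|[set e in E | v \in e]| + #|E'|.
  rewrite -(cardsID [set e : {set T} | v \in e] E); congr (_ + _); apply: eq_card => e.
    by rewrite !inE.
  by rewrite !inE andbC.
have := deg v; lia.
Qed.

(** * The upper bound *)

Lemma disjoint_pair_transversals (T : finType) (p q : {set T}) (X : {set {set T}}) :
  #|p| = 2 -> #|q| = 2 -> [disjoint p & q] -> {in X, forall e : {set T}, #|e| = 2} ->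
  {in X, forall e : {set T}, ~~ [disjoint e & p] && ~~ [disjoint e & q]} -> #|X| <= 4.
Proof.
move=> p2 q2 dpq X2 hits.
have -> : 4 = #|setX p q| by rewrite cardsX p2 q2.
apply: leq_trans (leq_imset_card (fun z => [set z.1; z.2]) _).
apply: subset_leq_card; apply/subsetP => e eX.
have /andP[/pred0Pn[u /andP[/= ue up]] /pred0Pn[v /andP[/= ve vq]]] := hits e eX.
apply/imsetP; exists (u, v); first by rewrite inE /= up.
apply: set_eq_pair (X2 e eX) ue ve _.
by apply: contraTneq vq => <-; rewrite (disjointFr dpq up).
Qed.

Lemma card_edges_meeting_edge (T : finType) (e : {set T}) (X : {set {set T}}) d :
  #|e| = 2 -> (forall v, #|[set f in X | v \in f]| <= d) ->
  {in X, forall f : {set T}, ~~ [disjoint e & f]} -> #|X| <= 2 * d.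
Proof.
move=> e2 deg hits; rewrite -e2 -sum_nat_const.
apply: leq_trans (_ : \sum_(v in e) #|[set f in X | v \in f]| <= _); last first.
  exact: leq_sum.
rewrite -sum_cardI_degree -sum1_card; apply: leq_sum => f fX.
by rewrite card_gt0 setIC setI_eq0 hits.
Qed.

Definition cross_intersecting (T : finType) (X Y : {set {set T}}) :=
  {in X & Y, forall e f : {set T}, ~~ [disjoint e & f]}.

(** By the Chvatal-Hanson bound such a graph has at most 5 * 4 + 2 = 22 edges. *)
Definition small_graph (T : finType) (X : {set {set T}}) :=
  [/\ {in X, forall e : {set T}, #|e| = 2},
      (forall v, #|[set e in X | v \in e]| <= 5) &
      (forall M : {set {set T}}, M \subset X -> trivIset M -> #|M| <= 4)].

Lemma cross_intersectingC (T : finType) (X Y : {set {set T}}) :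
  cross_intersecting X Y -> cross_intersecting Y X.
Proof. by move=> XY e f eY fX; rewrite disjoint_sym; apply: XY. Qed.

(** Edges of [Y] and [Z] join [p] to [q], at most four in each. If there is one, all edges of [X]
    meet it, so [X] has at most 10 and the total is at most 18; otherwise only the at most 22 edges
    of [X] count. *)
Lemma card_cross_intersecting_disjoint_pair (T : finType) (X Y Z : {set {set T}}) p q :
  small_graph X -> small_graph Y -> small_graph Z ->
  cross_intersecting X Y -> cross_intersecting X Z ->
  p \in X -> q \in X -> [disjoint p & q] -> #|X| + #|Y| + #|Z| <= 22.
Proof.
move=> [X2 degX matX] [Y2 _ _] [Z2 _ _] XY XZ pX qX dpq.
have transversal (W : {set {set T}}) : {in W, forall e : {set T}, #|e| = 2} ->
    cross_intersecting X W -> #|W| <= 4 /\ (0 < #|W| -> #|X| <= 10).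
  move=> W2 XW; split.
    apply: disjoint_pair_transversals (X2 p pX) (X2 q qX) dpq W2 _ => e eW.
    by rewrite ![[disjoint e & _]]disjoint_sym !XW.
  case/card_gt0P => e eW; apply: card_edges_meeting_edge (W2 e eW) degX _ => f fX.
  by rewrite disjoint_sym XW.
have [Y4 XleY] := transversal Y Y2 XY; have [Z4 XleZ] := transversal Z Z2 XZ.
have := card_graph_bound X2 degX matX; rewrite (_ : 4 %/ 3 = 1) // => X22.
case: (posnP #|Y|) (posnP #|Z|) => [Y0|/XleY Xle] [Z0|/XleZ Xle']; lia.
Qed.

(** A graph with two disjoint edges can take the role of [X] in the previous lemma; if there is
    none, all three have matching number at most 1, hence at most 5 edges each. *)
Lemma card_cross_intersecting_triple (T : finType) (X Y Z : {set {set T}}) :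
  small_graph X -> small_graph Y -> small_graph Z ->
  cross_intersecting X Y -> cross_intersecting X Z -> cross_intersecting Y Z ->
  #|X| + #|Y| + #|Z| <= 22.
Proof.
move=> sX sY sZ XY XZ YZ.
have small (W : {set {set T}}) : small_graph W ->
    #|W| <= 5 \/ exists p q, [/\ p \in W, q \in W & [disjoint p & q]].
  move=> [W2 degW _].
  have [/exists_inP[p pW /exists_inP[q qW dpq]]|] :=
    boolP [exists p in W, exists q in W, [disjoint p & q]].
    by right; exists p, q.
  move=> /exists_inPn intersecting; left; rewrite -[5]/(5 * 1 + 2 * (1 %/ 3)).
  apply: card_graph_bound W2 degW _ => M /subsetP MW /trivIsetP triv.
  apply/card_le1_eqP => e f eM fM; apply/eqP/negPn/negP => nef.
  have /exists_inPn/(_ f (MW f fM)) := intersecting e (MW e eM).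
  by rewrite disjoint_sym triv.
have [X5|[p [q [pX qX dpq]]]] := small X sX; last first.
  exact: (card_cross_intersecting_disjoint_pair sX sY sZ XY XZ pX qX dpq).
have [Y5|[p [q [pY qY dpq]]]] := small Y sY; last first.
  rewrite [#|X| + _]addnC.
  exact: (card_cross_intersecting_disjoint_pair sY sX sZ (cross_intersectingC XY) YZ pY qY dpq).
have [Z5|[p [q [pZ qZ dpq]]]] := small Z sZ; last first.
  rewrite addnC addnA.
  exact: (card_cross_intersecting_disjoint_pair sZ sX sY (cross_intersectingC XZ)
    (cross_intersectingC YZ) pZ qZ dpq).
lia.
Qed.

(** [sunflower] asks for exactly [k] members, so [k] of them are picked from a larger [S]. *)
Lemma sunflower_free_lt (T : finType) k (F S : {set {set T}}) (C : {set T}) :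
  sunflower_free k F -> S \subset F ->
  {in S &, forall A B, A != B -> A :&: B = C} -> #|S| < k.
Proof.
move=> freeF SF coreS; rewrite ltnNge; apply/negP => /card_geqP[s [us sizes ss]].
have sS : [set A in s] \subset S by apply/subsetP => A; rewrite inE => /ss.
apply: (freeF [set A in s] (subset_trans sS SF)); split.
  by rewrite cardsE (card_uniqP us).
by exists C => A B /(subsetP sS) AS /(subsetP sS) BS; apply: coreS.
Qed.

(** * Links in a sunflower-free family of triples *)

Section Uniform3.
Variables (T : finType) (F : {set {set T}}).
Hypotheses (F3 : uniform 3 F) (freeF : sunflower_free 6 F).

(** Distinct triples through [x] and [y] meet exactly in [[set x; y]], the core of a sunflower. *)
Lemma card_codegree_le5 x y : x != y -> #|[set A in F | (x \in A) && (y \in A)]| <= 5.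
Proof.
move=> xy; rewrite -ltnS; apply: (sunflower_free_lt (C := [set x; y]) freeF).
  by apply/subsetP => A; rewrite inE => /andP[].
move=> A B; rewrite !inE => /and3P[AF xA yA] /and3P[BF xB yB] nAB.
apply/esym/eqP; rewrite eqEcard cards2 xy; apply/andP; split.
  by rewrite subsetI !subUset !sub1set xA yA xB yB.
rewrite leqNgt; apply: contra nAB => AB3.
have AB : A :&: B = A by apply/eqP; rewrite eqEcard subsetIl F3.
by rewrite eqEcard !F3 // leqnn andbT -AB subsetIr.
Qed.

Section Link.
Variables (x : T) (X : {set {set T}}).
Hypotheses (XF : X \subset F) (xX : {in X, forall A : {set T}, x \in A}).

Definition link := [set A :\ x | A in X].

Lemma card_link : #|link| = #|X|.
Proof.
apply: card_in_imset => A B /xX xA /xX xB AB.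
by rewrite -(setD1K xA) -(setD1K xB) AB.
Qed.

Lemma link_edge : {in link, forall e : {set T}, #|e| = 2}.
Proof.
move=> _ /imsetP[A AX ->]; have := F3 (subsetP XF _ AX).
by rewrite (cardsD1 x) xX // => -[].
Qed.

Lemma link_degree v : #|[set e in link | v \in e]| <= 5.
Proof.
have [<-|xv] := eqVneq x v.
  rewrite (_ : [set _ in _ | _] = set0) ?cards0 //; apply/setP => e; rewrite !inE.
  by apply/negP => /andP[/imsetP[A _ ->]]; rewrite !inE eqxx.
apply: leq_trans (card_codegree_le5 xv).
apply: leq_trans (leq_imset_card (fun A => A :\ x) _).
apply: subset_leq_card; apply/subsetP => e; rewrite inE => /andP[/imsetP[A AX ->]].
rewrite !inE => /andP[_ vA]; apply: imset_f.
by rewrite inE vA xX // (subsetP XF).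
Qed.

(** Putting [x] back turns disjoint edges into a sunflower with core [[set x]]. *)
Lemma link_matching (M : {set {set T}}) : M \subset link -> trivIset M -> #|M| <= 5.
Proof.
move=> /subsetP ML /trivIsetP triv.
have xM e : e \in M -> x \notin e.
  by move=> /ML/imsetP[A _ ->]; rewrite !inE eqxx.
have /card_in_imset <- : {in M &, injective (setU [set x])}.
  by move=> e f /xM xe /xM xf ef; rewrite -(setU1K xe) -(setU1K xf) ef.
rewrite -ltnS; apply: (sunflower_free_lt (C := [set x]) freeF).
  apply/subsetP => _ /imsetP[e /ML/imsetP[A AX ->] ->].
  by rewrite setD1K ?xX // (subsetP XF).
move=> _ _ /imsetP[e eM ->] /imsetP[f fM ->] ef.
rewrite -setUIr; have /eqP-> : e :&: f == set0.
  by rewrite setI_eq0 triv //; apply: contraNneq ef => ->.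
by rewrite setU0.
Qed.

End Link.

Lemma card_degree_le27 v : #|[set A in F | v \in A]| <= 27.
Proof.
have XF : [set A in F | v \in A] \subset F by apply/subsetP => A; rewrite inE => /andP[].
have xX : {in [set A in F | v \in A], forall A : {set T}, v \in A}.
  by move=> A; rewrite inE => /andP[].
(* Here 5 * 5 + 2 * 1 = 27. *)
rewrite -(card_link xX); apply: (card_graph_bound (m := 5)).
- exact: link_edge.
- exact: link_degree.
- exact: link_matching.
Qed.

(** * Counting against a maximum disjoint subfamily *)

Variable M : {set {set T}}.
Hypothesis maxM : is_max_matching F M.
Let V := cover M.

Definition meeting_only a := [set A in F | A :&: V == [set a]].

Let MF : M \subset F. Proof. by case: (max_matchingP maxM). Qed.
Let trivM : trivIset M. Proof. by case: (max_matchingP maxM). Qed.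

Lemma meeting_only_sub a : meeting_only a \subset F.
Proof. by apply/subsetP => A; rewrite inE => /andP[]. Qed.

Lemma meeting_only_mem a A v : A \in meeting_only a -> v \in A -> v \in V -> v = a.
Proof.
rewrite inE => /andP[_ /eqP AV] vA vV; apply/set1P.
by rewrite -AV inE vA.
Qed.

Lemma mem_meeting_only a : {in meeting_only a, forall A : {set T}, a \in A}.
Proof.
move=> A; rewrite inE => /andP[_ /eqP AV].
have : a \in A :&: V by rewrite AV inE.
by rewrite inE => /andP[].
Qed.

Lemma meeting_only_notin a A : A \in meeting_only a -> A \notin M.
Proof.
move=> Aa; apply/negP => AM; have := F3 (subsetP MF _ AM).
move: Aa; rewrite inE => /andP[_]; rewrite (setIidPl (bigcup_sup _ AM)) => /eqP->.
by rewrite cards1.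
Qed.

(** [B :\ a] lies in [V], which members of [meeting_only a] meet only in [a]; so it extends every
    matching of this link, and the bound 5 drops to 4. *)
Lemma small_link a B : B \in M -> a \in B -> small_graph (link a (meeting_only a)).
Proof.
move=> BM aB; split.
- exact: link_edge (meeting_only_sub a) (@mem_meeting_only a).
- exact: link_degree (meeting_only_sub a) (@mem_meeting_only a).
move=> N /subsetP NL trivN.
have BF := subsetP MF _ BM.
have Bcard : #|B :\ a| = 2 by have := F3 BF; rewrite (cardsD1 a) aB => -[].
have dis : [disjoint B :\ a & cover N].
  apply/pred0P => z /=; apply/negP; rewrite !inE => /andP[/andP[za zB]].
  move=> /bigcupP[_ /NL/imsetP[A Aa ->]]; rewrite !inE => /andP[_ zA].
  move/eqP: za; apply; apply: meeting_only_mem Aa zA _.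
  by apply/bigcupP; exists B.
have BN : B :\ a \notin N.
  apply/negP => BN; move: dis; rewrite -setI_eq0.
  by rewrite (setIidPl (bigcup_sup _ BN)) -cards_eq0 Bcard.
have : #|B :\ a |: N| <= 5.
  apply: (link_matching (x := a) (X := B |: meeting_only a)).
  - by rewrite subUset sub1set BF meeting_only_sub.
  - by move=> A; rewrite !inE => /predU1P[->//|]; have := @mem_meeting_only a A; rewrite inE.
  - apply/subsetP => e; rewrite in_setU1 => /predU1P[->|/NL/imsetP[A Aa ->]].
      by apply: imset_f; rewrite setU11.
    by apply: imset_f; rewrite in_setU1 Aa orbT.
  - exact: trivIset_insert.
by rewrite cardsU1 BN.
Qed.

(** Disjoint edges of the two links would come from disjoint [A] and [A'], which could replace [B]
    in [M] and give a larger disjoint subfamily. *)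
Lemma cross_links a b B : B \in M -> a \in B -> b \in B -> a != b ->
  cross_intersecting (link a (meeting_only a)) (link b (meeting_only b)).
Proof.
move=> BM aB bB ab _ _ /imsetP[A Aa ->] /imsetP[A' Ab ->]; apply/negP => dis.
have dAA : [disjoint A & A'].
  apply/pred0P => z /=; apply/negP => /andP[zA zA'].
  have [zV|zV] := boolP (z \in V).
    by move/eqP: ab; apply; rewrite -(meeting_only_mem Aa zA zV) -(meeting_only_mem Ab zA' zV).
  have zB x : x \in B -> z != x.
    by move=> xB; apply: contraNneq zV => ->; apply/bigcupP; exists B.
  by have /pred0P/(_ z) := dis; rewrite /= !inE !zB // zA zA'.
have dB c C : c \in B -> C \in meeting_only c -> [disjoint C & cover (M :\ B)].
  move=> cB Cc; apply/pred0P => z /=; apply/negP => /andP[zC /bigcupP[g]].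
  rewrite !inE => /andP[gB gM] zg.
  have zV : z \in V by apply/bigcupP; exists g.
  move: zg; rewrite (meeting_only_mem Cc zC zV) => cg.
  by move/eqP: gB; apply; apply: trivIset_eq trivM gM BM cg cB.
have AA : A != A'.
  apply/eqP => AA; move: dAA; rewrite -AA -setI_eq0 setIid => /eqP A0.
  by have := mem_meeting_only Aa; rewrite A0 inE.
have [_ _ /(_ (A |: (A' |: (M :\ B))))] := max_matchingP maxM.
rewrite /is_matching !subUset !sub1set !(subsetP (meeting_only_sub _) _ Aa).
rewrite (subsetP (meeting_only_sub _) _ Ab) (subset_trans (subsetDl _ _) MF) /=.
rewrite !trivIset_insert ?(trivIsetS (subsetDl _ _) trivM) //.
- rewrite !cardsU1 !inE (negbTE AA) (negbTE (meeting_only_notin Aa)).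
  by rewrite (negbTE (meeting_only_notin Ab)) !andbF (cardsD1 B M) BM ltnn => /(_ isT).
- rewrite /cover bigcup_setU big_set1 -setI_eq0 setIUr setU_eq0 !setI_eq0 dAA.
  exact: dB aB Aa.
- exact: dB bB Ab.
Qed.

Lemma card_meeting_block B : B \in M -> \sum_(a in B) #|meeting_only a| <= 22.
Proof.
move=> BM; have B3 := F3 (subsetP MF _ BM).
have /card_gt0P[a aB] : 0 < #|B| by rewrite B3.
have /eqP/cards2P[b [c [bc Bbc]]] : #|B :\ a| = 2.
  by move: B3; rewrite (cardsD1 a) aB => -[].
have : b \in B :\ a by rewrite Bbc !inE eqxx.
have : c \in B :\ a by rewrite Bbc !inE eqxx orbT.
rewrite !inE => /andP[ca cB] /andP[ba bB].
rewrite (big_setD1 a) //= Bbc big_setU1 ?inE //= big_set1 addnA.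
have linkE x := card_link (@mem_meeting_only x).
rewrite -!linkE; apply: card_cross_intersecting_triple.
- exact: small_link aB.
- exact: small_link bB.
- exact: small_link cB.
- by apply: cross_links BM _ _ _ => //; rewrite eq_sym.
- by apply: cross_links BM _ _ _ => //; rewrite eq_sym.
- exact: cross_links BM _ _ _.
Qed.

Lemma card_sunflower_free_matching : 2 * #|F| <= 102 * #|M|.
Proof.
have cV : #|V| = #|M| * 3.
  rewrite -(eqP (trivM : trivIset M)) -sum_nat_const.
  by apply: eq_bigr => B BM; rewrite F3 // (subsetP MF).
(* Members of [M] have all 3 points in [V]; any other set meets [V] by maximality, and the last term
   makes up for a single common point. *)
have count_A A : A \in F -> 2 + (A \in M) <= #|A :&: V| + (#|A :&: V| == 1).
  move=> AF; have [AM|_] := boolP (A \in M).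
    by rewrite (setIidPl (bigcup_sup _ AM)) F3.
  have F0 : set0 \notin F by apply/negP => /F3; rewrite cards0.
  have := max_matching_hits F0 maxM AF.
  rewrite -setI_eq0 -cards_eq0.
  by case: #|_| => [|[|n]].
have : \sum_(A in F) (2 + (A \in M)) <= \sum_(A in F) (#|A :&: V| + (#|A :&: V| == 1)).
  exact: leq_sum.
rewrite !big_split /= sum_nat_const sum_cardI_degree.
have -> : \sum_(A in F) (A \in M : nat) = #|M|.
  rewrite -sum1_card big_mkcond [RHS]big_mkcond /=; apply: eq_bigr => A _.
  by case: ifP => [_|/negP AF]; case: ifP => // /(subsetP MF).
have deg : \sum_(v in V) #|[set A in F | v \in A]| <= #|V| * 27.
  by rewrite -sum_nat_const; apply: leq_sum => v _; apply: card_degree_le27.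
have one : \sum_(A in F) (#|A :&: V| == 1 : nat) <= #|M| * 22.
  apply: leq_trans (_ : \sum_(B in M) \sum_(a in B) #|meeting_only a| <= _); last first.
    by rewrite -sum_nat_const; apply: leq_sum => B; apply: card_meeting_block.
  (* The blocks of [M] partition [V], and each set meeting [V] in one point is counted at that
     point. *)
  rewrite -(big_trivIset (op := addn) _ trivM).
  have -> : \sum_(a in V) #|meeting_only a| = \sum_(a in V) \sum_(A in F) (A :&: V == [set a] : nat).
    apply: eq_bigr => a _; rewrite -sum1_card big_mkcond [RHS]big_mkcond /=.
    by apply: eq_bigr => A _; rewrite inE; case: (A \in F); case: eqP.
  rewrite exchange_big; apply: leq_sum => A AF /=.
  case: eqP => // /eqP/cards1P[a AV].
  have aV : a \in V by move/setP/(_ a): AV; rewrite !inE eqxx => /andP[].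
  by rewrite (bigD1 a) //= AV eqxx.
rewrite cV in deg.
have arith f m s : f * 2 + m <= s -> s <= m * 3 * 27 + m * 22 ->
  2 * f <= 102 * m by lia.
by move=> total; apply: arith total (leq_add deg one).
Qed.

End Uniform3.

Lemma card_sunflower_free_3_6 (T : finType) (F : {set {set T}}) :
  uniform 3 F -> sunflower_free 6 F -> #|F| <= 255.
Proof.
move=> F3 freeF; have [M mM] := max_matching_exists F.
have [MF /trivIsetP triv _] := max_matchingP mM.
(* Disjoint sets form a sunflower with empty core; five of them give 102 * 5 / 2 = 255. *)
have : #|M| < 6.
  apply: (sunflower_free_lt (C := set0) freeF MF) => A B AM BM AB.
  by apply/eqP; rewrite setI_eq0 triv.
have := card_sunflower_free_matching F3 freeF mM; lia.
Qed.

(** * The lower bound *)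

Lemma weighted_packing (T : finType) (w : T -> nat) c (S : {set {set T}}) :
  trivIset S -> {in S, forall A : {set T}, c <= \sum_(x in A) w x} ->
  #|S| * c <= \sum_x w x.
Proof.
move=> trivS cw; rewrite -sum_nat_const.
apply: leq_trans (_ : \sum_(A in S) \sum_(x in A) w x <= _); first exact: leq_sum.
rewrite -(big_trivIset (op := addn) _ trivS) [leqRHS](bigID (mem (cover S))) /=.
exact: leq_addr.
Qed.

Lemma sunflower_core_sub (T : finType) k (S : {set {set T}}) (C A : {set T}) :
  #|S| = k.+2 -> {in S &, forall A B, A != B -> A :&: B = C} -> A \in S -> C \subset A.
Proof.
move=> Sk core AS.
have /card_gt0P[B] : 0 < #|S :\ A| by have := Sk; rewrite (cardsD1 A) AS add1n => -[->].
by rewrite !inE => /andP[BA BS]; rewrite -(core A B) ?subsetIl // eq_sym.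
Qed.

Definition neighbours (T : finType) (F : {set {set T}}) (x : T) :=
  [set y | (y != x) && [exists A in F, (x \in A) && (y \in A)]].

(** The cases are the sizes of the core: if it is empty, six disjoint sets weigh at least 18; a
    single core point has 12 neighbours in the petals; two core points lie in six common triples. *)
Lemma sunflower_free_criterion (T : finType) (F : {set {set T}}) (w : T -> nat) :
  uniform 3 F ->
  {in F, forall A : {set T}, 3 <= \sum_(x in A) w x} -> \sum_x w x <= 17 ->
  (forall x, #|neighbours F x| <= 11) ->
  (forall x y, x != y -> #|[set A in F | (x \in A) && (y \in A)]| <= 5) ->
  sunflower_free 6 F.
Proof.
move=> F3 w3 w17 nbr codeg S SF [S6 [C core]].
have coreS A : A \in S -> C \subset A by apply: sunflower_core_sub S6 core.
have [C0|[x xC]] := set_0Vmem C.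
  have trivS : trivIset S.
    by apply/trivIsetP => A B AS BS AB; rewrite -setI_eq0 (core A B) ?C0.
  have := weighted_packing trivS (sub_in1 (subsetP SF) w3).
  by rewrite S6 => /leq_trans/(_ w17).
have xS : {in S, forall A : {set T}, x \in A}.
  by move=> A /coreS/subsetP; apply.
have [C1|[y]] := set_0Vmem (C :\ x); last first.
  rewrite !inE => /andP[yx yC]; have := codeg y x yx.
  apply/negP; rewrite -ltnNge -S6; apply: subset_leq_card; apply/subsetP => A AS.
  by rewrite inE (subsetP SF) // xS // (subsetP (coreS A AS)).
have trivL : trivIset (link x S).
  apply/trivIsetP => _ _ /imsetP[A AS ->] /imsetP[B BS ->] AB.
  rewrite -setI_eq0 -setDIl (core A B) ?C1 //.
  by apply: contraNneq AB => ->.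
have coverL : cover (link x S) \subset neighbours F x.
  apply/subsetP => y /bigcupP[_ /imsetP[A AS ->]]; rewrite !inE => /andP[-> yA].
  by apply/exists_inP; exists A; rewrite ?(subsetP SF) // xS.
have := leq_trans (subset_leq_card coverL) (nbr x).
rewrite -(eqP trivL).
under eq_bigr => e eL do rewrite (link_edge F3 SF xS eL).
by rewrite sum_nat_const card_link // S6.
Qed.

(* Nine base blocks modulo 14: every nonzero difference other than 1, -1 and 7 occurs
   five times, the difference 7 occurs twice, and 1, -1 never occur. *)
Definition base_blocks : seq (nat * nat) :=
  [:: (2, 4); (2, 5); (2, 6); (2, 8); (3, 7); (3, 8); (3, 9); (3, 10); (4, 9)].

(** Sorting represents each triple by a unique list, so that distinct lists are distinct sets. *)
Definition cyclic_triples : seq (seq nat) :=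
  [seq sort leq [:: i; (i + b.1) %% 14; (i + b.2) %% 14] | b <- base_blocks, i <- iota 0 14].

(** The circulant graph on 11 vertices with steps 1 and 2 is 4-regular; five disjoint chords raise
    the degree to 5 everywhere but at 8. *)
Definition star_edges : seq (nat * nat) :=
  [seq (i, (i + d) %% 11) | d <- [:: 1; 2], i <- iota 0 11] ++
  [:: (0, 3); (1, 4); (2, 5); (6, 9); (7, 10)].

(** The star has centre 14 and its link on the points 15 to 25, which makes 26 points in all. *)
Definition triples : seq (seq nat) :=
  cyclic_triples ++ [seq sort leq [:: 14; 15 + e.1; 15 + e.2] | e <- star_edges].

Definition ord_set (l : seq nat) : {set 'I_26} := [set i : 'I_26 | val i \in l].

Definition triple_family : {set {set 'I_26}} := [set A in map ord_set triples].

Lemma triple_familyP (A : {set 'I_26}) :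
  reflect (exists2 l, l \in triples & A = ord_set l) (A \in triple_family).
Proof. by rewrite inE; apply: mapP. Qed.

(** Strict sortedness serves for cardinality and injectivity of [ord_set]; the last clause separates
    the star from the cyclic part when weighing. *)
Lemma triples_ok : all (fun l => [&& sorted ltn l, size l == 3, all (ltn^~ 26) l &
  (14 \in l) || all (ltn^~ 14) l]) triples.
Proof. by vm_compute. Qed.

(** This reduces cardinalities of sets of ordinals to counts that [vm_compute] can evaluate. *)
Lemma card_ord_pred n (p : pred nat) : #|[set i : 'I_n | p i]| = count p (iota 0 n).
Proof.
rewrite cardsE cardE -size_filter -val_enum_ord filter_map size_map.
by rewrite [enum 'I_n]enumT.
Qed.

Lemma card_ord_set l : l \in triples -> #|ord_set l| = 3.
Proof.
move=> /(allP triples_ok)/and4P[sl /eqP l3 /allP l26 _].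
rewrite /ord_set (card_ord_pred 26 (mem l)) -size_filter.
transitivity (size l) => //; apply/perm_size.
have ul : uniq l := sorted_uniq ltn_trans ltnn sl.
apply: uniq_perm => // [|i]; first exact/filter_uniq/iota_uniq.
rewrite mem_filter mem_iota /=; apply: andb_idr; exact: l26.
Qed.

Lemma ord_set_inj : {in triples &, injective ord_set}.
Proof.
move=> l l' /(allP triples_ok)/and4P[sl _ /allP l26 _].
move=> /(allP triples_ok)/and4P[sl' _ /allP l26' _] /setP ll'.
apply: irr_sorted_eq ltn_trans ltnn _ _ sl sl' _ => i.
have [i26|i26] := ltnP i 26; first by have := ll' (Ordinal i26); rewrite !inE.
by apply/idP/idP => [/l26|/l26'] /=; rewrite ltnNge i26.
Qed.

Lemma card_triple_family : #|triple_family| = 153.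
Proof.
rewrite cardsE; have /card_uniqP-> : uniq (map ord_set triples).
  by rewrite map_inj_in_uniq; [vm_compute | apply: ord_set_inj].
by rewrite size_map; vm_compute.
Qed.

Lemma triple_family_uniform : uniform 3 triple_family.
Proof. by move=> _ /triple_familyP[l lt ->]; apply: card_ord_set. Qed.

(* Every triple weighs at least 3 and the total weight is 17, so six triples are never disjoint. *)
Definition point_weight (i : nat) := if i < 14 then 1 else if i == 14 then 3 else 0.

Lemma triple_family_neighbours (x : 'I_26) : #|neighbours triple_family x| <= 11.
Proof.
pose p (a b : nat) := (b != a) && has (fun l => (a \in l) && (b \in l)) triples.
have /allP/(_ (val x)) : all (fun a => count (p a) (iota 0 26) <= 11) (iota 0 26).
  by vm_compute.
rewrite mem_iota ltn_ord => /(_ isT); apply: leq_trans.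
rewrite -card_ord_pred; apply: subset_leq_card; apply/subsetP => y.
rewrite !inE => /andP[yx /exists_inP[_ /triple_familyP[l lt ->]]].
rewrite !inE => xyl; rewrite /p yx; apply/hasP; by exists l.
Qed.

Lemma triple_family_codegree (x y : 'I_26) : x != y ->
  #|[set A in triple_family | (x \in A) && (y \in A)]| <= 5.
Proof.
move=> xy.
have /allP/(_ (val x)) : all (fun a => all (fun b => (a == b) ||
    (count (fun l => (a \in l) && (b \in l)) triples <= 5)) (iota 0 26)) (iota 0 26).
  by vm_compute.
rewrite mem_iota ltn_ord => /(_ isT)/allP/(_ (val y)).
rewrite mem_iota ltn_ord val_eqE (negbTE xy) => /(_ isT); apply: leq_trans.
rewrite -size_filter -(size_map ord_set); apply: leq_trans (card_size _).
apply: subset_leq_card; apply/subsetP => A.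
rewrite inE => /andP[/triple_familyP[l lt ->]]; rewrite !inE => xyl.
by apply: map_f; rewrite mem_filter xyl.
Qed.

Lemma triple_family_weight :
  {in triple_family, forall A : {set 'I_26}, 3 <= \sum_(i in A) point_weight i}.
Proof.
move=> _ /triple_familyP[l lt ->].
have /and4P[_ _ _ /orP[l14|/allP l14]] := allP triples_ok l lt.
  rewrite (bigD1 (Ordinal (isT : 14 < 26))) ?inE //=; exact: leq_addr.
apply: leq_trans (_ : #|ord_set l| <= _); first by rewrite card_ord_set.
rewrite -sum1_card; apply: leq_sum => i; rewrite inE => /l14 /= i14.
by rewrite /point_weight i14.
Qed.

Lemma sunflower_free_size_153 : sunflower_free_size 3 6 153.
Proof.
exists 'I_26, triple_family; split; last exact: card_triple_family.
  exact: triple_family_uniform.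
apply: (sunflower_free_criterion triple_family_uniform triple_family_weight).
- by rewrite !big_ord_recr big_ord0.
- exact: triple_family_neighbours.
- exact: triple_family_codegree.
Qed.

(** A nonempty bounded set of sizes has a maximum, so the default value 0 does not arise; [asbool]
    supplies the boolean predicate for [ex_maxnP]. *)
Lemma sunflower_number_bounds w k a b :
  sunflower_free_size w k a -> (forall n, sunflower_free_size w k n -> n <= b) ->
  a <= sunflower_number w k <= b.
Proof.
move=> sa ub; pose P n := boolp.asbool (sunflower_free_size w k n).
have exP : exists n, P n by exists a; apply/boolp.asboolP.
have ubP n : P n -> n <= b by move=> /boolp.asboolP/ub.
case: (ex_maxnP exP ubP) => m /boolp.asboolP sm maxm.
have max_size n : sunflower_free_size w k n -> n <= m.
  by move=> sn; apply: maxm; apply/boolp.asboolP.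
by rewrite (@sunflower_numberE w k m) // max_size // ub.
Qed.

Theorem theorem7p3 : 153 <= sunflower_number 3 6 <= 255.
Proof.
apply: sunflower_number_bounds sunflower_free_size_153 _ => _ [T [F [F3 freeF <-]]].
exact: card_sunflower_free_3_6.
Qed.
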